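(* Suppose each $f_i$ is strongly convex with constant $\mu_i>0$, $i=1,\dots,m$; let $\mu=\min_i\mu_i$, $L_h=(1/\mu)(2+2\cos(\pi/m))$ and $h=-g$. Let $\{\boldsymbol{\lambda}^{(k)}\}_{k\ge0}$ be generated by the inexact dual algorithm with distortions satisfying $\|\mathbf{r}_i^{(k)}\|\le\varepsilon_i$ for all $i,k$ and with stepsizes satisfying $0<\gamma_k\le1/L_h$ for all $k\ge0$ and $\sum_{k=0}^\infty\gamma_k=\infty$. Then: 1. $\displaystyle\limsup_k\ \min_{i\in\{0,\dots,k\}}\|\nabla h(\boldsymbol{\lambda}^{(i)})\|\le\epsilon$. 2. If $\gamma_k=\gamma/(k+1)^p$ with $0<\gamma\le1/L_h$ and $0\le p\le1$, then there is a constant $C$ (independent of $k$) such that for all sufficiently large $k$, $$\min_{i\in\{0,\dots,k\}}\|\nabla h(\boldsymbol{\lambda}^{(i)})\|\le C\,b_k+\epsilon,$$ where $b_k=1/\sqrt{k^{1-p}}$ if $p\in[0,1)$ and $b_k=1/\sqrt{\log k}$ if $p=1$. Among these bounds the best order is $O(1/\sqrt{k})$, achieved when $p=0$, i.e. the fixed stepsize.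
   Context: Let $m\ge2$, $n\ge1$ be integers, $\mathcal{Y}\subseteq\mathbb{R}^n$ a nonempty closed convex set, and $f_i:\mathbb{R}^n\to\mathbb{R}$, $i=1,\dots,m$, strictly convex closed functions. For $\mathbf{y}=(\mathbf{y}_1,\dots,\mathbf{y}_m)\in(\mathbb{R}^n)^m=\mathbb{R}^{nm}$ put $f(\mathbf{y})=\sum_{i=1}^m f_i(\mathbf{y}_i)$, let $\bar{\mathcal{Y}}=\mathcal{Y}^m$, and $\mathbf{A}\mathbf{y}=(\mathbf{y}_1-\mathbf{y}_2,\dots,\mathbf{y}_{m-1}-\mathbf{y}_m)\in\mathbb{R}^{n(m-1)}$. The dual function is $g(\boldsymbol{\lambda})=\inf_{\mathbf{y}\in\bar{\mathcal{Y}}}\big[f(\mathbf{y})+\boldsymbol{\lambda}^{T}\mathbf{A}\mathbf{y}\big]$, $\boldsymbol{\lambda}\in\mathbb{R}^{n(m-1)}$; when all $f_i$ are strongly convex, $g$ is differentiable. Inexact dual algorithm: start from any $\boldsymbol{\lambda}^{(0)}\in\mathbb{R}^{n(m-1)}$; for $k=0,1,2,\dots$ let $\mathbf{y}^{(k)}=\arg\min_{\mathbf{y}\in\bar{\mathcal{Y}}}\big[f(\mathbf{y})+(\boldsymbol{\lambda}^{(k)})^{T}\mathbf{A}\mathbf{y}\big]$, let $\hat{\mathbf{y}}_i^{(k)}=\mathbf{y}_i^{(k)}+\mathbf{r}_i^{(k)}$ where $\mathbf{r}_i^{(k)}\in\mathbb{R}^n$ are arbitrary distortions, let $\hat{\mathbf{d}}^{(k)}=\mathbf{A}\hat{\mathbf{y}}^{(k)}$,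 and set $\boldsymbol{\lambda}^{(k+1)}=\boldsymbol{\lambda}^{(k)}+\gamma_k\hat{\mathbf{d}}^{(k)}$. The distortions are bounded by constants: $\|\mathbf{r}_i^{(k)}\|\le\varepsilon_i$ for all $i$ and $k$, and $\epsilon:=\sqrt{\sum_{i=1}^{m-1}(\varepsilon_i+\varepsilon_{i+1})^2}$. Norms are Euclidean. A function $\varphi$ is strongly convex with constant $\sigma>0$ if $\varphi-\frac{\sigma}{2}\|\cdot\|^2$ is convex. *)

(* Defs.v *)
From HB Require Import structures.
From mathcomp Require Import all_boot all_order all_algebra.
From mathcomp Require Import all_classical all_reals all_analysis.

Set Implicit Arguments.
Unset Strict Implicit.
Unset Printing Implicit Defensive.

Import Order.TTheory GRing.Theory Num.Theory.
Import numFieldNormedType.Exports.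

Local Open Scope classical_set_scope.
Local Open Scope ring_scope.

(* A block vector (v_1, ..., v_q) in (R^n)^q is the matrix 'M[R]_(q, n) whose
   i-th row is v_i. The library norm on matrices is the sup norm, hence the
   explicit Euclidean structure. *)
Section euclidean.
Context {R : realType} {q n : nat}.
Implicit Types A B : 'M[R]_(q, n).

Definition edot A B : R := \sum_(i < q) \sum_(j < n) A i j * B i j.

Definition enorm A : R := Num.sqrt (edot A A).

(* This is the gradient for edot at the points where F is differentiable;
   elsewhere its entries may be junk values of lim. *)
Definition gradient (F : 'M[R]_(q, n) -> R) (A : 'M[R]_(q, n)) : 'M[R]_(q, n) :=
  \matrix_(i, j) ('D_(delta_mx i j) F A).

End euclidean.

Section convexity.
Context {R : realType} {n : nat}.
Implicit Types phi : 'rV[R]_n -> R.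

Definition strictly_convex phi :=
  forall (x y : 'rV[R]_n) (t : R), x != y -> 0 < t < 1 ->
    phi (t *: x + (1 - t) *: y) < t * phi x + (1 - t) * phi y.

Definition strongly_convex (s : R) phi :=
  convex_function [set: 'rV[R]_n] (fun x => phi x - s / 2 * enorm x ^+ 2).

Definition closed_function phi :=
  closed [set p : 'rV[R]_n * R | phi p.1 <= p.2].

End convexity.

(* For i < m - 1 (0-based), the indices i and i + 1 seen in 'I_m. *)
Definition ord_fst {m : nat} (i : 'I_m.-1) : 'I_m := widen_ord (leq_pred m) i.
Definition ord_snd {m : nat} (i : 'I_m.-1) : 'I_m :=
  Ordinal (etrans (esym (ltn_predRL i m)) (ltn_ord i)).

Section dual.
Context {R : realType} {m n : nat}.
Implicit Types (f : 'I_m -> 'rV[R]_n -> R) (Y : set 'rV[R]_n).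
Implicit Types (y : 'M[R]_(m, n)) (lam : 'M[R]_(m.-1, n)).

Definition diffA y : 'M[R]_(m.-1, n) :=
  \matrix_(i < m.-1) (row (ord_fst i) y - row (ord_snd i) y).

Definition prodY Y : set 'M[R]_(m, n) := [set y | forall i, Y (row i y)].

Definition lagrangian f lam y : R :=
  \sum_(i < m) f i (row i y) + edot lam (diffA y).

Definition dual_fun f Y lam : \bar R :=
  ereal_inf [set (lagrangian f lam y)%:E | y in prodY Y].

Definition neg_dual f Y lam : R := - fine (dual_fun f Y lam).

Definition is_argmin (T : Type) (D : set T) (F : T -> R) (x : T) :=
  D x /\ forall z, D z -> F x <= F z.

Definition inexact_dual_algorithm f Y (gamma : nat -> R)
    (r : nat -> 'M[R]_(m, n)) (y : nat -> 'M[R]_(m, n))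
    (lam : nat -> 'M[R]_(m.-1, n)) :=
  forall k, is_argmin (prodY Y) (lagrangian f (lam k)) (y k) /\
    lam k.+1 = lam k + gamma k *: diffA (y k + r k).

Definition total_error (e : 'I_m -> R) : R :=
  Num.sqrt (\sum_(i < m.-1) (e (ord_fst i) + e (ord_snd i)) ^+ 2).

Definition min_const (hm : (1 < m)%N) (mu : 'I_m -> R) : R :=
  \big[Num.min/mu (Ordinal (ltnW hm))]_(i < m) mu i.

Definition lipschitz_const (hm : (1 < m)%N) (mu : 'I_m -> R) : R :=
  1 / min_const hm mu * (2 + 2 * cos (pi / m%:R)).

End dual.

Definition running_min {R : realType} (u : nat -> R) (k : nat) : R :=
  \big[Num.min/u 0%N]_(i < k.+1) u i.

Definition rate {R : realType} (p : R) (k : nat) : R :=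
  if p == 1 then 1 / Num.sqrt (ln k%:R)
  else 1 / Num.sqrt (k%:R `^ (1 - p)).

(* Main.v *)
Require Import Defs.
From HB Require Import structures.
From mathcomp Require Import all_boot all_order all_algebra.
From mathcomp Require Import all_classical all_reals all_analysis.
From mathcomp Require Import ring lra.

(** For a multiplier [l], let [y(l)] be the minimizer over [Y^m] of the Lagrangian,
which is strongly convex with constant [mu]. Quadratic growth of the Lagrangian
around [y(l)], together with [|A w|^2 <= (2 + 2 cos (pi / m)) |w|^2], gives
[h(l) - <d, A y(l)> <= h(l + d) <= h(l) - <d, A y(l)> + L/2 |d|^2], so that [h] is
differentiable with gradient [- A y(l)]. As [gamma <= 1 / L], one inexact step
decreases [h] by at least [gamma/2 (|grad h|^2 - eps^2)]; since [h] is bounded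
below, summation gives [min |grad h|^2 <= eps^2 + D / sum gamma], and the rates
follow by bounding [sum gamma] from below. *)

Set Implicit Arguments.
Unset Strict Implicit.
Unset Printing Implicit Defensive.

Import Order.TTheory GRing.Theory Num.Theory.
Import numFieldNormedType.Exports.

Local Open Scope classical_set_scope.
Local Open Scope ring_scope.

(** * Euclidean geometry of block vectors, and comparison with the sup norm *)

Section euclidean_theory.
Context {R : realType} {q n : nat}.
Implicit Types A B C : 'M[R]_(q, n).

Lemma edotC A B : edot A B = edot B A.
Proof. by apply: eq_bigr => i _; apply: eq_bigr => j _; rewrite mulrC. Qed.

Lemma edotDl A B C : edot (A + B) C = edot A C + edot B C.
Proof.
rewrite /edot -big_split; apply: eq_bigr => i _ /=.
by rewrite -big_split; apply: eq_bigr => j _; rewrite mxE mulrDl.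
Qed.

Lemma edotZl a A B : edot (a *: A) B = a * edot A B.
Proof.
rewrite /edot mulr_sumr; apply: eq_bigr => i _.
by rewrite mulr_sumr; apply: eq_bigr => j _; rewrite mxE mulrA.
Qed.

Lemma edotNl A B : edot (- A) B = - edot A B.
Proof. by rewrite -scaleN1r edotZl mulN1r. Qed.

Lemma edotBl A B C : edot (A - B) C = edot A C - edot B C.
Proof. by rewrite edotDl edotNl. Qed.

Lemma edotDr A B C : edot A (B + C) = edot A B + edot A C.
Proof. by rewrite edotC edotDl !(edotC A). Qed.

Lemma edotZr a A B : edot A (a *: B) = a * edot A B.
Proof. by rewrite edotC edotZl (edotC A). Qed.

Lemma edotNr A B : edot A (- B) = - edot A B.
Proof. by rewrite edotC edotNl (edotC A). Qed.

Lemma edotBr A B C : edot A (B - C) = edot A B - edot A C.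
Proof. by rewrite edotDr edotNr. Qed.

Lemma edot_ge0 A : 0 <= edot A A.
Proof. by apply: sumr_ge0 => i _; apply: sumr_ge0 => j _; rewrite -expr2 sqr_ge0. Qed.

Lemma enorm_ge0 A : 0 <= enorm A.
Proof. exact: sqrtr_ge0. Qed.

Lemma sqr_enorm A : enorm A ^+ 2 = edot A A.
Proof. exact/sqr_sqrtr/edot_ge0. Qed.

Lemma enormN A : enorm (- A) = enorm A.
Proof. by rewrite /enorm edotNl edotNr opprK. Qed.

Lemma sqr_entry_le_edot A i j : A i j ^+ 2 <= edot A A.
Proof.
rewrite /edot (bigD1 i)//= (bigD1 j)//= -expr2 -addrA lerDl addr_ge0//.
  by apply: sumr_ge0 => k _; rewrite -expr2 sqr_ge0.
by apply: sumr_ge0 => k _; apply: sumr_ge0 => l _; rewrite -expr2 sqr_ge0.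
Qed.

Lemma edot_delta A i j : edot A (delta_mx i j) = A i j.
Proof.
rewrite /edot (bigD1 i)//= (bigD1 j)//= mxE !eqxx mulr1.
rewrite [X in _ + X + _]big1 => [|k /negPf kj]; last by rewrite mxE kj andbF mulr0.
rewrite addr0 big1 ?addr0// => k /negPf ki.
by rewrite big1// => l _; rewrite mxE ki mulr0.
Qed.

Lemma edot_sum_row A B : edot A B = \sum_i edot (row i A) (row i B).
Proof.
apply: eq_bigr => i _; rewrite /edot big_ord1.
by apply: eq_bigr => j _; rewrite !mxE.
Qed.

Lemma edot_Cauchy_Schwarz A B : edot A B ^+ 2 <= edot A A * edot B B.
Proof.
have [B0|Bneq0] := eqVneq (edot B B) 0.
  suff -> : B = 0 by rewrite -(scale0r B) !edotZr !mul0r expr0n mulr0.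
  apply/matrixP => i j; rewrite mxE; apply/eqP; rewrite -sqrf_eq0 eq_le sqr_ge0.
  by rewrite andbT -B0 sqr_entry_le_edot.
have B0 : 0 < edot B B by rewrite lt_neqAle eq_sym Bneq0 edot_ge0.
(* Division-free projection: the square of [edot B B *: A - edot A B *: B] expands to [edot B B]
   times the Cauchy-Schwarz gap. *)
have := edot_ge0 (edot B B *: A - edot A B *: B).
rewrite !(edotBl, edotBr, edotZl, edotZr) (edotC B A).
set a := edot A A; set b := edot B B in B0 *; set c := edot A B => H.
have : 0 <= b * (a * b - c ^+ 2) by lra.
by rewrite pmulr_rge0// subr_ge0.
Qed.

Lemma edot_le_enorm A B : edot A B <= enorm A * enorm B.
Proof.
have := edot_Cauchy_Schwarz A B; rewrite -!sqr_enorm -exprMn => H.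
apply: le_trans (ler_norm _) _.
by rewrite -(@ler_pXn2r _ 2)// ?nnegrE ?mulr_ge0 ?enorm_ge0// real_normK ?num_real.
Qed.

Lemma enormD A B : enorm (A + B) <= enorm A + enorm B.
Proof.
rewrite -(@ler_pXn2r _ 2)// ?nnegrE ?addr_ge0 ?enorm_ge0//.
rewrite sqr_enorm !(edotDl, edotDr) (edotC B) sqrrD !sqr_enorm.
have := edot_le_enorm A B; lra.
Qed.

Lemma edot_convex A B t : edot (t *: A + (1 - t) *: B) (t *: A + (1 - t) *: B) =
  t * edot A A + (1 - t) * edot B B - t * (1 - t) * edot (A - B) (A - B).
Proof.
rewrite !(edotDl, edotDr, edotNl, edotNr, edotZl, edotZr) (edotC B A).
by ring.
Qed.

Lemma norm_entry_le A i j : `|A i j| <= `|A|.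
Proof.
rewrite [leRHS]/Num.norm/= mx_normrE.
exact: (@le_bigmax _ _ _ _ (fun ij : 'I_q * 'I_n => `|A ij.1 ij.2|) (i, j)).
Qed.

(** The topology on matrices comes from the sup norm; this transfers Euclidean Cauchy estimates to
    it. *)
Lemma norm_le_enorm A : `|A| <= enorm A.
Proof.
rewrite [leLHS]/Num.norm/= mx_normrE; apply/bigmax_leP; split; first exact: enorm_ge0.
move=> [i j] _ /=; rewrite -(@ler_pXn2r _ 2)// ?nnegrE ?enorm_ge0//.
by rewrite real_normK ?num_real// sqr_enorm sqr_entry_le_edot.
Qed.

Lemma abs_edot_le A B :
  `|edot A B| <= (\sum_i \sum_j `|A i j|) * `|B|.
Proof.
rewrite mulr_suml; apply: le_trans (ler_norm_sum _ _ _) _.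
apply: ler_sum => i _; rewrite mulr_suml; apply: le_trans (ler_norm_sum _ _ _) _.
by apply: ler_sum => j _; rewrite normrM ler_wpM2l// norm_entry_le.
Qed.

End euclidean_theory.

Lemma row_norm_le {R : realType} {q n : nat} (A : 'M[R]_(q, n)) i :
  `|row i A| <= `|A|.
Proof.
rewrite [leLHS]/Num.norm/= mx_normrE; apply/bigmax_leP; split => //.
by move=> [k j] _ /=; rewrite mxE norm_entry_le.
Qed.

(** * The largest eigenvalue of the path Laplacian *)

(** The two sides differ by the nonnegative term [(v * a + u * b) ^+ 2 / (u * v)]. *)
Lemma sqrB_le_weighted {R : realFieldType} (a b u v : R) : 0 < u -> 0 < v ->
  (a - b) ^+ 2 <= (1 + v / u) * a ^+ 2 + (1 + u / v) * b ^+ 2.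
Proof.
move=> u0 v0.
have -> : (1 + v / u) * a ^+ 2 + (1 + u / v) * b ^+ 2 =
  (a - b) ^+ 2 + (v * a + u * b) ^+ 2 / (u * v) by field; lra.
by rewrite lerDl divr_ge0 ?sqr_ge0 ?mulr_ge0 ?ltW.
Qed.

Section path_laplacian.
Context {R : realType}.

(** With [t = pi / m] this equals [2 cos (t / 2) sin ((k + 1/2) t)]; the sum form avoids half
    angles. *)
Let v (m k : nat) : R := sin (k.+1%:R * (pi / m%:R)) + sin (k%:R * (pi / m%:R)).

(** For the alternating vector [(-1)^k v m k] this is an interior row of the eigenvalue equation of
    the path Laplacian; the next two facts are its first and last rows. *)
Let v_rec m k : v m k.+2 + v m k = 2 * cos (pi / m%:R) * v m k.+1.
Proof.
rewrite /v; set t := pi / m%:R.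
have E j : sin (j.+2%:R * t) + sin (j%:R * t) = 2 * cos t * sin (j.+1%:R * t).
  have -> : j.+2%:R * t = j.+1%:R * t + t by rewrite [in LHS]mulrS; ring.
  have -> : j%:R * t = j.+1%:R * t - t by rewrite [in RHS]mulrS; ring.
  by rewrite sinD sinB; ring.
by rewrite mulrDr -!E; ring.
Qed.

Let v0 m : v m 1 = (1 + 2 * cos (pi / m%:R)) * v m 0.
Proof.
rewrite /v; set t := pi / m%:R.
have -> : 2%:R * t = t + t by ring.
by rewrite mul0r sin0 mul1r sinD; ring.
Qed.

Let vm m : (0 < m)%N -> v m m = - v m m.-1.
Proof.
case: m => // m _; rewrite /v /= (mulrS 1 m.+1).
have -> : m%:R = m.+1%:R - 1 :> R by rewrite -natr1 addrK.
have : m.+1%:R != 0 :> R by rewrite pnatr_eq0.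
move: (m.+1%:R : R) => M M0.
have -> : (1 + M) * (pi / M) = pi / M + pi by field.
have -> : M * (pi / M) = pi by field.
have -> : (M - 1) * (pi / M) = pi - pi / M by field.
by rewrite sinDpi sinpi sinB sinpi cospi; ring.
Qed.

Let v_gt0 m k : (1 < m)%N -> (k < m)%N -> 0 < v m k.
Proof.
move=> m1 km.
have m0 : 0 < m%:R :> R by rewrite ltr0n ltnW.
have p0 : 0 < pi :> R := pi_gt0 R.
have s0 j : (0 < j < m)%N -> 0 < sin (j%:R * (pi / m%:R)) :> R.
  move=> /andP[j0 jm]; apply: sin_gt0_pi; rewrite mulr_gt0 ?ltr0n ?divr_gt0//=.
  by rewrite mulrA ltr_pdivrMr// mulrC ltr_pM2l// ltr_nat.
rewrite /v; case: k km => [|k] km; first by rewrite mul0r sin0 addr0 s0.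
apply: ltr_wpDl; last by rewrite s0.
apply: sin_ge0_pi; rewrite mulr_ge0 ?divr_ge0 ?(ltW p0)//=.
by rewrite mulrA ler_pdivrMr// mulrC ler_pM2l// ler_nat.
Qed.

(* The weights [v m k] are the absolute values of the entries of an eigenvector
   of the path Laplacian for its largest eigenvalue [2 + 2 cos (pi / m)]. *)
Lemma path_laplacian_le m (w : nat -> R) : (1 < m)%N ->
  \sum_(i < m.-1) (w i - w i.+1) ^+ 2 <=
  (2 + 2 * cos (pi / m%:R)) * \sum_(i < m) w i ^+ 2.
Proof.
move=> m1; set c := 2 + 2 * cos (pi / m%:R).
(* Induction along the path: the term subtracted at [w k] is the reserve that pays for the next
   difference. At [k = m - 1] the reflection [vm] makes its coefficient zero. *)
suff H k : (k < m)%N -> \sum_(i < k) (w i - w i.+1) ^+ 2 <=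
    c * \sum_(i < k.+1) w i ^+ 2 - (1 + v m k.+1 / v m k) * w k ^+ 2.
  have m0 := ltnW m1; have := H m.-1; rewrite prednK// leqnn => /(_ isT).
  rewrite vm// mulNr divff ?subrr ?mul0r ?subr0//.
  by rewrite gt_eqF// v_gt0// prednK.
elim: k => [|k IH] km.
  rewrite big_ord0 big_ord1 -mulrBl v0 mulfK ?gt_eqF ?v_gt0//.
  by rewrite /c [X in _ <= X * _](_ : _ = 0) ?mul0r//; ring.
have {}IH := IH (ltnW km).
have vk : 0 < v m k by rewrite v_gt0// ltnW.
have vk1 : 0 < v m k.+1 by rewrite v_gt0.
have E : 1 + v m k.+2 / v m k.+1 = c - (1 + v m k / v m k.+1).
  have -> : v m k.+2 = 2 * cos (pi / m%:R) * v m k.+1 - v m k.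
    by rewrite -v_rec; ring.
  by rewrite /c; field; rewrite gt_eqF.
rewrite big_ord_recr [X in _ <= _ * X - _]big_ord_recr /= E.
have := sqrB_le_weighted (w k) (w k.+1) vk vk1; lra.
Qed.

End path_laplacian.

(** * Norm bounds for the difference operator *)

Section difference_operator.
Context {R : realType} {m n : nat}.
Implicit Types y z : 'M[R]_(m, n).

Lemma diffAE y i j : diffA y i j = y (ord_fst i) j - y (ord_snd i) j.
Proof. by rewrite !mxE. Qed.

Lemma diffAD y z : diffA (y + z) = diffA y + diffA z.
Proof. by apply/matrixP => i j; rewrite !mxE; ring. Qed.

Lemma diffAZ a y : diffA (a *: y) = a *: diffA y.
Proof. by apply/matrixP => i j; rewrite !mxE; ring. Qed.

Lemma diffAN y : diffA (- y) = - diffA y.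
Proof. by rewrite -scaleN1r diffAZ scaleN1r. Qed.

Lemma diffAB y z : diffA (y - z) = diffA y - diffA z.
Proof. by rewrite diffAD diffAN. Qed.

(** The columns decouple: in each one [diffA] takes the differences along a path on [m] vertices, so
    the Laplacian bound applies column by column. *)
Lemma edot_diffA_le y : (1 < m)%N ->
  edot (diffA y) (diffA y) <= (2 + 2 * cos (pi / m%:R)) * edot y y.
Proof.
move=> m1; rewrite /edot exchange_big [X in _ <= _ * X]exchange_big mulr_sumr /=.
apply: ler_sum => j _.
(* The column as a sequence on [nat]; the default 0 at indices from [m] on is never read. *)
pose w (k : nat) := if insub k is Some i then y i j else 0.
have wE (i : 'I_m) : y i j = w i by rewrite /w valK.
under eq_bigr do rewrite diffAE !wE -expr2.
under [X in _ <= _ * X]eq_bigr do rewrite !wE -expr2.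
exact: path_laplacian_le.
Qed.

(** The triangle inequality in each block of differences; this is how distortions of the blocks turn
    into the error [total_error e] on the dual gradient. *)
Lemma enorm_diffA_le_total_error y (e : 'I_m -> R) :
  (forall i, enorm (row i y) <= e i) -> enorm (diffA y) <= total_error e.
Proof.
move=> ye; rewrite ler_wsqrtr// edot_sum_row; apply: ler_sum => i _.
rewrite rowK -sqr_enorm ler_pXn2r// ?nnegrE ?enorm_ge0//.
  by apply: le_trans (enormD _ _) _; rewrite enormN lerD.
by rewrite addr_ge0// (le_trans (enorm_ge0 _) (ye _)).
Qed.

End difference_operator.

(** * Gradients obtained from two-sided quadratic estimates *)

HB.instance Definition _ (R : realType) (q n : nat) (G : 'M[R]_(q, n)) :=
  GRing.isLinear.Build R 'M[R]_(q, n) R *%R (edot G)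
    (fun a A B => etrans (edotDr G (a *: A) B) (congr1 (+%R ^~ _) (edotZr a G A))).

Section gradient_of_quadratic_approximation.
Context {R : realType} {q n : nat}.
Implicit Types (F : 'M[R]_(q, n) -> R) (G x : 'M[R]_(q, n)).

Lemma edot_continuous G : continuous (edot G).
Proof.
apply: bounded_linear_continuous; apply/linear_boundedP.
near=> r => x; apply: le_trans (abs_edot_le _ _) _; rewrite ler_wpM2r//.
Unshelve. all: by end_near. Qed.

Lemma edot_le_sqr_norm G : edot G G <= (q * n)%:R * `|G| ^+ 2.
Proof.
apply: le_trans (ler_norm _) _; apply: le_trans (abs_edot_le _ _) _.
rewrite expr2 mulrA ler_wpM2r//.
apply: (@le_trans _ _ (\sum_(i < q) \sum_(j < n) `|G|)).
  by apply: ler_sum => i _; apply: ler_sum => j _; exact: norm_entry_le.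
by rewrite !sumr_const !card_ord -mulrnA mulr_natl mulnC.
Qed.

(** The error [c * edot d d] is of second order in the sup norm, at the price of a factor [q * n],
    hence negligible against [d]. *)
Lemma quadratic_approximation_littleo F G x c :
  (forall d, `|F (d + x) - F x - edot G d| <= c * edot d d) ->
  (F : 'M[R]_(q, n) -> R^o) \o shift x =
  cst (F x) + edot G +o_ (0 : 'M[R]_(q, n)) id.
Proof.
move=> FG; apply/eqaddoP => _/posnumP[e].
(* The added 1 keeps [K] positive even if [c] or [q * n] vanishes, so that dividing by [K] is
   safe. *)
pose K := `|c| * (q * n)%:R + 1.
have K0 : 0 < K by rewrite ltr_pwDr// mulr_ge0.
have eK : 0 < e%:num / K by rewrite divr_gt0.
near=> d; rewrite /= !fctE /= opprD addrA; apply: le_trans (FG d) _.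
apply: (@le_trans _ _ (K * `|d| * `|d|)).
  rewrite -mulrA -expr2; apply: (@le_trans _ _ (`|c| * edot d d)).
    by rewrite ler_wpM2r ?edot_ge0 ?ler_norm.
  apply: (@le_trans _ _ (`|c| * ((q * n)%:R * `|d| ^+ 2))).
    by rewrite ler_wpM2l ?edot_le_sqr_norm.
  by rewrite mulrA ler_wpM2r ?sqr_ge0// /K lerDl.
rewrite ler_wpM2r// mulrC -ler_pdivlMr//; near: d.
Unshelve. all: by end_near. Qed.

Lemma differentiable_quadratic_approximation F G x c :
  (forall d, `|F (d + x) - F x - edot G d| <= c * edot d d) ->
  differentiable F x.
Proof.
move=> /quadratic_approximation_littleo FG; apply/diff_locallyP.
rewrite (diff_unique (@edot_continuous G) FG).
by split; [exact: edot_continuous|exact: FG].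
Qed.

Lemma gradient_quadratic_approximation F G x c :
  (forall d, `|F (d + x) - F x - edot G d| <= c * edot d d) ->
  gradient F x = G.
Proof.
move=> FG; have dF := differentiable_quadratic_approximation FG.
apply/matrixP => i j; rewrite mxE deriveE//.
rewrite (diff_unique (@edot_continuous G) (quadratic_approximation_littleo FG)).
exact: edot_delta.
Qed.

End gradient_of_quadratic_approximation.

(** * Existence of minimizers and growth around them under strong convexity *)

Section quadratic_convexity.
Context {R : realType} {q n : nat}.
Implicit Types (F : 'M[R]_(q, n) -> R) (D : set 'M[R]_(q, n)).

(** Strong convexity with the modulus written out: in this form it sums over blocks and is
    insensitive to added linear terms. *)
Definition quadratically_convex (s : R) F := forall y z t, 0 <= t <= 1 ->
  F (t *: y + (1 - t) *: z) <=
  t * F y + (1 - t) * F z - s / 2 * (t * (1 - t) * edot (y - z) (y - z)).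

Definition segment_closed D :=
  forall y z (t : R), D y -> D z -> 0 <= t <= 1 -> D (t *: y + (1 - t) *: z).

(** Minimality along the segment from [y] to [z] gives [F z - F y >= (1 - t) Q] for [0 < t <= 1],
    where [Q] is the quadratic term. Instead of [t] tending to 0, one small [t] refutes a supposed
    gap. *)
Lemma argmin_quadratic_growth (s : R) F D y z : quadratically_convex s F ->
  segment_closed D -> is_argmin D F y -> D z ->
  F y + s / 2 * edot (z - y) (z - y) <= F z.
Proof.
move=> Fs Dc [Dy ymin] Dz; rewrite leNgt; apply/negP.
set Q := s / 2 * edot (z - y) (z - y) => zQ.
have yz := ymin _ Dz.
have Q0 : 0 < Q by lra.
(* Chosen so that [t Q] is half of the supposed gap [Q - (F z - F y)]. *)
pose t := (Q - (F z - F y)) / (2 * Q).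
have Qt : Q * t = (Q - (F z - F y)) / 2 by rewrite /t; field; lra.
have t0 : 0 < t by rewrite divr_gt0//; lra.
have t1 : t <= 1 by rewrite ler_pdivrMr; lra.
have t01 : 0 <= t <= 1 by rewrite (ltW t0).
have := le_trans (ymin _ (Dc _ _ _ Dz Dy t01)) (Fs z y t t01).
have -> : s / 2 * (t * (1 - t) * edot (z - y) (z - y)) = t * (Q - Q * t).
  by rewrite /Q; ring.
rewrite Qt => H.
have : 0 <= t * ((F z - F y) - Q) by lra.
by rewrite pmulr_rge0//; lra.
Qed.

(* A minimizing sequence is Cauchy, by quadratic convexity at midpoints. *)
Lemma argmin_exists (s b : R) F D : 0 < s -> quadratically_convex s F ->
  segment_closed D -> closed D -> D !=set0 ->
  (forall x a, a < F x -> \forall z \near x, a < F z) ->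
  (forall z, D z -> b <= F z) -> exists y, is_argmin D F y.
Proof.
move=> s0 Fs Dc Dcl [x0 Dx0] Flsc Fb.
have hI : has_inf (F @` D).
  by split; [exists (F x0), x0|exists b => _ [z Dz <-]; exact: Fb].
set I := inf (F @` D).
have IF z : D z -> I <= F z by move=> Dz; apply: ge_inf; [exact: hI.2|exists z].
have /choice[u uP] : forall k : nat, exists z, D z /\ F z < I + k.+1%:R^-1.
  move=> k; have k0 : 0 < k.+1%:R^-1 :> R by rewrite invr_gt0.
  by have [_ [z Dz <-] zI] := inf_adherent k0 hI; exists z.
(* The midpoint stays in [D], so its value is at least [I], while both endpoint values are below
   [I + 1 / (k + 1)]; at [t = 1/2] the modulus is [s / 8]. *)
have ukl k l : (k <= l)%N -> s / 8 * edot (u k - u l) (u k - u l) < k.+1%:R^-1.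
  move=> kl; have h : 0 <= (2^-1 : R) <= 1 by lra.
  have [Dk Ik] := uP k; have [Dl Il] := uP l.
  have lk : l.+1%:R^-1 <= k.+1%:R^-1 :> R by rewrite lef_pV2 ?posrE// ler_nat.
  have := le_trans (IF _ (Dc _ _ _ Dk Dl h)) (Fs (u k) (u l) _ h).
  move: Ik Il lk; move: (k.+1%:R^-1) (l.+1%:R^-1) (edot _ _) => a c E.
  by lra.
have cu : cvgn u.
  apply/cauchy_cvgP/cauchy_exP => e e0.
  have e2 : 0 < s / 8 * e ^+ 2 by rewrite mulr_gt0 ?divr_gt0 ?exprn_gt0.
  have [N _ HN] := near_infty_natSinv_lt (PosNum e2).
  exists (u N); exists N => // k /= Nk; rewrite -ball_normE /=.
  apply: le_lt_trans (norm_le_enorm _) _.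
  rewrite -(@ltr_pXn2r _ 2)// ?nnegrE ?enorm_ge0 ?(ltW e0)// sqr_enorm.
  have s8 : 0 < s / 8 by rewrite divr_gt0.
  rewrite -(ltr_pM2l s8); apply: lt_trans (ukl _ _ Nk) _.
  exact: (HN N (leqnn N)).
have Dlim : D (limn u).
  by apply: (closed_cvg _ Dcl _ _ cu); apply: nearW => k; case: (uP k).
exists (limn u); split => // z /IF; apply: le_trans.
rewrite leNgt; apply/negP => Ilim.
(* Lower semicontinuity would keep [F (u k)] above the middle of [I] and [F (limn u)], against
   [F (u k) < I + 1 / (k + 1)]. *)
have d0 : 0 < (F (limn u) - I) / 2 by lra.
have mid : (F (limn u) + I) / 2 < F (limn u) by lra.
have near1 : \forall k \near \oo, (F (limn u) + I) / 2 < F (u k).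
  exact: cu _ (Flsc _ _ mid).
have near2 := near_infty_natSinv_lt (PosNum d0).
have [k [/= k1 k2]] := filter_ex (filterI near1 near2).
have [_] := uP k; move: k1 k2 => /=; move: (k.+1%:R^-1) => a.
by lra.
Qed.

End quadratic_convexity.

(** By the identity [edot_convex], the subtracted squares recombine exactly into the modulus. *)
Lemma strongly_convex_quadratically_convex {R : realType} {n : nat} (s : R)
    (phi : 'rV[R]_n -> R) :
  strongly_convex s phi -> quadratically_convex s phi.
Proof.
move=> H y z t /andP[t0 t1].
have {}H : phi (t *: y + (1 - t) *: z) -
      s / 2 * enorm (t *: y + (1 - t) *: z) ^+ 2 <=
    t * (phi y - s / 2 * enorm y ^+ 2) +
    (1 - t) * (phi z - s / 2 * enorm z ^+ 2).
  exact: (H (Itv01 t0 t1) y z (in_setT _) (in_setT _)).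
move: H; rewrite !sqr_enorm edot_convex.
move: (edot y y) (edot z z) (edot (y - z) _) => a b c.
by lra.
Qed.

(** The complement of the epigraph is open, so it contains a box around [(x, a)]; its slice at
    height [a] gives the neighbourhood. *)
Lemma closed_function_lsc {R : realType} {n : nat} (phi : 'rV[R]_n -> R) x a :
  closed_function phi -> a < phi x -> \forall z \near x, a < phi z.
Proof.
move=> /closed_openC cl ax.
have xa : nbhs (x, a) (~` [set p : 'rV[R]_n * R | phi p.1 <= p.2]).
  by apply: open_nbhs_nbhs; split => //=; apply/negP; rewrite -ltNge.
have [[A B] /= [nA nB] AB] := xa.
apply: filterS nA => z Az; rewrite ltNge; apply/negP.
by apply: (AB (z, a)); split => //=; exact: nbhs_singleton nB.
Qed.

Lemma row_continuous {R : realType} {q n : nat} (i : 'I_q) :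
  continuous (row i : 'M[R]_(q, n) -> 'rV[R]_n).
Proof.
apply: bounded_linear_continuous; apply/linear_boundedP.
near=> r => x; apply: le_trans (row_norm_le _ _) _.
by rewrite ler_peMl//; near: r; exact: nbhs_pinfty_ge.
Unshelve. all: by end_near. Qed.

HB.instance Definition _ (R : realType) (m n : nat) :=
  GRing.isLinear.Build R 'M[R]_(m, n) 'M[R]_(m.-1, n) *:%R (@diffA R m n)
    (fun a y z => etrans (diffAD (a *: y) z) (congr1 (+%R ^~ _) (diffAZ a y))).

Lemma diffA_continuous {R : realType} {m n : nat} :
  continuous (@diffA R m n).
Proof.
apply: bounded_linear_continuous; apply/linear_boundedP.
near=> r => y; apply: (@le_trans _ _ (2 * `|y|)); last by rewrite ler_wpM2r.
rewrite [leLHS]/Num.norm/= mx_normrE; apply/bigmax_leP; split; first exact: mulr_ge0.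
move=> [i j] _ /=; rewrite diffAE; apply: le_trans (ler_normB _ _) _.
by rewrite mulr_natl mulr2n lerD ?norm_entry_le.
Unshelve. all: by end_near. Qed.

(** * Convexity and semicontinuity of the Lagrangian, and its link to the dual *)

Section lagrangian_theory.
Context {R : realType} {m n : nat}.
Variables (f : 'I_m -> 'rV[R]_n -> R) (Y : set 'rV[R]_n).
Implicit Types (y z : 'M[R]_(m, n)) (l d : 'M[R]_(m.-1, n)).

Lemma segment_closed_prodY : convex_set Y ->
  segment_closed (prodY Y : set 'M[R]_(m, n)).
Proof.
move=> Yc y z t Yy Yz /andP[t0 t1] i; rewrite linearD !linearZ /=.
have := Yc (row i y) (row i z) (Itv01 t0 t1).
by rewrite !inE; apply; [exact: Yy|exact: Yz].
Qed.

Lemma closed_prodY : closed Y -> closed (prodY Y : set 'M[R]_(m, n)).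
Proof.
move=> Ycl.
have -> : prodY Y = \bigcap_(i in [set: 'I_m]) (row i @^-1` Y) :> set 'M[R]_(m, n).
  by apply/seteqP; split => [y Yy i _|y Yy i]; [exact: Yy|exact: (Yy i I)].
apply: closed_bigI => i _; apply: closed_comp => // y _.
exact: row_continuous.
Qed.

Lemma lagrangianDl l d y :
  lagrangian f (d + l) y = lagrangian f l y + edot d (diffA y).
Proof. by rewrite /lagrangian edotDl addrA addrAC. Qed.

(** Each modulus is lowered to [s] and summed over the blocks; the coupling term is linear in
    [y]. *)
Lemma lagrangian_quadratically_convex (s : R) (mu : 'I_m -> R) l :
  (forall i, s <= mu i) -> (forall i, strongly_convex (mu i) (f i)) ->
  quadratically_convex s (lagrangian f l).
Proof.
move=> smu fmu y z t t01; have /andP[t0 t1] := t01.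
have H : \sum_i f i (row i (t *: y + (1 - t) *: z)) <=
    \sum_i (t * f i (row i y) + (1 - t) * f i (row i z) -
    s / 2 * (t * (1 - t) * edot (row i (y - z)) (row i (y - z)))).
  apply: ler_sum => i _.
  have -> : row i (t *: y + (1 - t) *: z) = t *: row i y + (1 - t) *: row i z.
    by rewrite linearD !linearZ.
  have -> : row i (y - z) = row i y - row i z by rewrite linearB.
  have := strongly_convex_quadratically_convex (fmu i) (row i y) (row i z) t01.
  move/le_trans; apply; rewrite lerD2l lerN2 ler_wpM2r ?ler_pM2r//.
  by rewrite !mulr_ge0 ?edot_ge0 ?subr_ge0.
rewrite !big_split /= sumrN -!mulr_sumr -edot_sum_row in H.
rewrite /lagrangian diffAD !diffAZ edotDr !edotZr.
by move: H; move: (edot (y - z) _) => a; lra.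
Qed.

Lemma lagrangian_lsc l y a : (forall i, closed_function (f i)) ->
  a < lagrangian f l y -> \forall z \near y, a < lagrangian f l z.
Proof.
move=> fcl ay.
(* The gap is shared equally among the [m] functions and the linear term; strictness comes from the
   linear term alone. *)
pose e := (lagrangian f l y - a) / m.+1%:R.
have e0 : 0 < e by rewrite divr_gt0// subr_gt0.
have lin : \forall z \near y, edot l (diffA y) - e < edot l (diffA z).
  have c : (edot l \o diffA) z @[z --> y] --> edot l (diffA y).
    apply: (@continuous_comp _ _ _ diffA (edot l)).
      exact: diffA_continuous.
    exact: edot_continuous.
  by apply: (cvgr_gt _ c); rewrite ltrBlDr ltrDl.
have fi i : \forall z \near y, f i (row i y) - e < f i (row i z).
  have := @closed_function_lsc _ _ (f i) (row i y) (f i (row i y) - e) (fcl i).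
  by rewrite ltrBlDr ltrDl => /(_ e0)/row_continuous.
have fs : \forall z \near y, forall i, f i (row i y) - e < f i (row i z).
  exact: filter_forall fi.
near=> z.
apply: (@le_lt_trans _ _ (\sum_i (f i (row i y) - e) + (edot l (diffA y) - e))).
  rewrite big_split /= sumrN sumr_const card_ord -mulr_natr.
  rewrite addrACA -opprD -/(lagrangian f l y).
  have -> : e * m%:R + e = lagrangian f l y - a.
    by rewrite -[X in _ + X]mulr1 -mulrDr natr1 /e divfK.
  by rewrite subKr.
apply: ler_ltD; last by near: z.
apply: ler_sum => i _; apply/ltW; move: i; near: z; exact: fs.
Unshelve. all: by end_near. Qed.

Lemma dual_fun_argmin l y :
  is_argmin (prodY Y) (lagrangian f l) y -> dual_fun f Y l = (lagrangian f l y)%:E.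
Proof.
move=> [Yy ymin]; apply/eqP; rewrite eq_le; apply/andP; split.
  by apply: ereal_inf_lbound; exists y.
by apply: le_ereal_inf_tmp => _ [z Yz <-]; rewrite lee_fin ymin.
Qed.

Lemma neg_dual_argmin l y :
  is_argmin (prodY Y) (lagrangian f l) y -> neg_dual f Y l = - lagrangian f l y.
Proof. by move=> /dual_fun_argmin; rewrite /neg_dual => ->. Qed.

End lagrangian_theory.

(** With [c = 2 + 2 cos (pi / m)], expand the square of [c *: d + s *: diffA w], bound the square of
    [diffA w] by [c * edot w w], and divide by [2 c s]. *)
Lemma edot_diffA_young {R : realType} {m n : nat} (s : R)
    (d : 'M[R]_(m.-1, n)) (w : 'M[R]_(m, n)) : (1 < m)%N -> 0 < s ->
  - ((2 + 2 * cos (pi / m%:R)) / s / 2 * edot d d) <=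
  s / 2 * edot w w + edot d (diffA w).
Proof.
move=> m1 s0; have := edot_diffA_le w m1; set c := 2 + _ => H.
have c0 : 0 < c.
  have : 0 <= cos (pi / m%:R) :> R.
    have m0 : 0 < m%:R :> R by rewrite ltr0n ltnW.
    apply: cos_ge0_pihalf; apply/andP; split.
      by apply: (@le_trans _ _ 0); rewrite ?oppr_le0 divr_ge0// pi_ge0.
    by rewrite ler_pM2l ?pi_gt0// lef_pV2 ?posrE// ler_nat.
  by rewrite /c; lra.
have := edot_ge0 (c *: d + s *: diffA w).
rewrite !(edotDl, edotDr, edotZl, edotZr) (edotC (diffA w) d).
move: H; move: (edot d d) (edot d (diffA w)) (edot w w) (edot (diffA w) _).
move=> a b x v H1 H2.
have -> : - (c / s / 2 * a) = - (c * (c * a)) / (2 * c * s) by field; lra.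
rewrite ler_pdivrMr ?mulr_gt0//.
have : s * (s * v) <= s * (s * (c * x)) by rewrite !ler_pM2l.
have -> : (s / 2 * x + b) * (2 * c * s) = s * (s * (c * x)) + 2 * (c * (s * b)).
  by field.
by move=> H3; lra.
Qed.

(** * Smoothness of the negative dual and decrease along one inexact step *)

Section dual_smoothness.
Context {R : realType} {m n : nat}.
Variables (hm : (1 < m)%N) (Y : set 'rV[R]_n) (f : 'I_m -> 'rV[R]_n -> R).
Variable mu : 'I_m -> R.
Hypotheses (Ycl : closed Y) (Ycv : convex_set Y).
Hypotheses (fcl : forall i, closed_function (f i)) (mu_gt0 : forall i, 0 < mu i).
Hypothesis fmu : forall i, strongly_convex (mu i) (f i).
Implicit Types (y z : 'M[R]_(m, n)) (l d : 'M[R]_(m.-1, n)).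

Let s := min_const hm mu.
Let L := lipschitz_const hm mu.

Let s_gt0 : 0 < s.
Proof. by apply/bigmin_gtP; split. Qed.

Let s_le i : s <= mu i.
Proof. exact: bigmin_le. Qed.

(** Quadratic growth around [y] absorbs the change of the coupling term, by the Young-type bound at
    [z - y]. It serves both the existence of minimizers and the descent inequality. *)
Lemma lagrangian_argmin_perturbation l d y z :
  is_argmin (prodY Y) (lagrangian f l) y -> prodY Y z ->
  lagrangian f l y + edot d (diffA y) - L / 2 * edot d d <=
  lagrangian f (d + l) z.
Proof.
move=> ymin Yz; rewrite lagrangianDl.
have := argmin_quadratic_growth (lagrangian_quadratically_convex l s_le fmu)
  (segment_closed_prodY Ycv) ymin Yz.
have := edot_diffA_young d (z - y) hm s_gt0.
rewrite diffAB edotBr.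
have -> : (2 + 2 * cos (pi / m%:R)) / s = L.
  by rewrite /L /lipschitz_const mul1r mulrC.
by move: (edot (z - y) _) (L / 2 * _) => a b; lra.
Qed.

(** One known minimizer bounds the Lagrangian below at every other multiplier, which is the bound a
    minimizing sequence needs. *)
Lemma lagrangian_argmin_exists l0 y0 l :
  is_argmin (prodY Y) (lagrangian f l0) y0 ->
  exists y, is_argmin (prodY Y) (lagrangian f l) y.
Proof.
move=> y0min.
pose b := lagrangian f l0 y0 + edot (l - l0) (diffA y0) -
  L / 2 * edot (l - l0) (l - l0).
apply: (@argmin_exists _ _ _ s b) s_gt0 (lagrangian_quadratically_convex l s_le fmu)
  (segment_closed_prodY Ycv) (closed_prodY Ycl) _ _ _.
- by exists y0; case: y0min.
- by move=> x a; exact: lagrangian_lsc.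
- move=> z Yz; rewrite -[in leRHS](subrK l0 l).
  exact: lagrangian_argmin_perturbation.
Qed.

Lemma neg_dual_quadratic_upper l d y y' :
  is_argmin (prodY Y) (lagrangian f l) y ->
  is_argmin (prodY Y) (lagrangian f (d + l)) y' ->
  neg_dual f Y (d + l) <=
  neg_dual f Y l - edot d (diffA y) + L / 2 * edot d d.
Proof.
move=> ymin y'min; rewrite (neg_dual_argmin ymin) (neg_dual_argmin y'min).
have := lagrangian_argmin_perturbation d ymin y'min.1.
by move: (L / 2 * _) => a; lra.
Qed.

(** The minimizer at [l] is a competitor at [d + l]; thus [- diffA y] is a subgradient. *)
Lemma neg_dual_affine_lower l d y y' :
  is_argmin (prodY Y) (lagrangian f l) y ->
  is_argmin (prodY Y) (lagrangian f (d + l)) y' ->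
  neg_dual f Y l - edot d (diffA y) <= neg_dual f Y (d + l).
Proof.
move=> ymin y'min; rewrite (neg_dual_argmin ymin) (neg_dual_argmin y'min).
by have := y'min.2 _ ymin.1; rewrite [leRHS]lagrangianDl; lra.
Qed.

Lemma neg_dual_quadratic_approximation l y :
  is_argmin (prodY Y) (lagrangian f l) y ->
  forall d, `|neg_dual f Y (d + l) - neg_dual f Y l - edot (- diffA y) d| <=
    L / 2 * edot d d.
Proof.
move=> ymin d; have [y' y'min] := lagrangian_argmin_exists (d + l) ymin.
have up := neg_dual_quadratic_upper ymin y'min.
have lo := neg_dual_affine_lower ymin y'min.
rewrite edotNl edotC ger0_norm; last by lra.
by move: up; move: (L / 2 * _) => a; lra.
Qed.

Lemma differentiable_neg_dual l y :
  is_argmin (prodY Y) (lagrangian f l) y -> differentiable (neg_dual f Y) l.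
Proof.
move=> /neg_dual_quadratic_approximation.
exact: differentiable_quadratic_approximation.
Qed.

Lemma gradient_neg_dual l y :
  is_argmin (prodY Y) (lagrangian f l) y -> gradient (neg_dual f Y) l = - diffA y.
Proof.
move=> /neg_dual_quadratic_approximation.
exact: gradient_quadratic_approximation.
Qed.

(** At the consensus point with all blocks equal to [x] the coupling term vanishes, so the value
    there is the same for all multipliers. *)
Lemma neg_dual_lower_bound x l y : Y x ->
  is_argmin (prodY Y) (lagrangian f l) y ->
  - \sum_i f i x <= neg_dual f Y l.
Proof.
move=> Yx ymin; rewrite (neg_dual_argmin ymin) lerN2.
pose z : 'M[R]_(m, n) := \matrix_(i < m) x.
have zx i : row i z = x by rewrite rowK.
have /ymin.2 : prodY Y z by move=> i; rewrite zx.
rewrite [leRHS]/lagrangian.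
have -> : diffA z = 0 by apply/matrixP => i j; rewrite !mxE subrr.
by rewrite linear0 addr0; under eq_bigr do rewrite zx.
Qed.

(** With [D = A y + A r] and [g L <= 1], the change is at most [g/2 (|D|^2 - 2 <D, A y>) = g/2 (|A
    r|^2 - |A y|^2)]: the cross term cancels, and [- A y] is the gradient. *)
Lemma neg_dual_inexact_step l y y' r g e : 0 < g <= 1 / L ->
  is_argmin (prodY Y) (lagrangian f l) y ->
  is_argmin (prodY Y) (lagrangian f (l + g *: diffA (y + r))) y' ->
  enorm (diffA r) <= e ->
  neg_dual f Y (l + g *: diffA (y + r)) <=
  neg_dual f Y l - g / 2 * (enorm (gradient (neg_dual f Y) l) ^+ 2 - e ^+ 2).
Proof.
move=> /andP[g0 gL] ymin; rewrite addrC => y'min re.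
apply: le_trans (neg_dual_quadratic_upper ymin y'min) _.
rewrite (gradient_neg_dual ymin) enormN sqr_enorm.
(* Positivity of [L] is read off from the nonempty stepsize range. *)
have L0 : 0 < L.
  have : 0 < 1 / L := lt_le_trans g0 gL.
  by rewrite div1r invr_gt0.
have re2 : edot (diffA r) (diffA r) <= e ^+ 2.
  by rewrite -sqr_enorm ler_pXn2r// ?nnegrE ?enorm_ge0// (le_trans (enorm_ge0 _) re).
have gL1 : g * L <= 1 by rewrite -ler_pdivlMr.
set D := diffA (y + r); rewrite !edotZl !edotZr.
have H1 : L / 2 * (g * (g * edot D D)) <= g / 2 * edot D D.
  have -> : L / 2 * (g * (g * edot D D)) = (g * L) * (g / 2 * edot D D) by ring.
  by rewrite ler_piMl// mulr_ge0 ?edot_ge0// divr_ge0// ltW.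
have H2 : g / 2 * edot (diffA r) (diffA r) <= g / 2 * e ^+ 2.
  by rewrite ler_pM2l// divr_gt0.
move: H1; rewrite /D diffAD !(edotDl, edotDr) (edotC (diffA r) (diffA y)).
by move: H2; rewrite !(mulrDr, mulrN, mulrBr); lra.
Qed.

End dual_smoothness.

(** * From one-step decrease to a bound on the running minimum *)

Section running_min_theory.
Context {R : realType}.
Implicit Types (u g h : nat -> R).

Lemma running_min_le u k i : (i <= k)%N -> running_min u k <= u i.
Proof.
move=> ik; rewrite /running_min.
exact: (@bigmin_le _ _ _ _ (Ordinal (ik : (i < k.+1)%N)) (fun i : 'I_k.+1 => u i)).
Qed.

Lemma running_min_ge0 u k : (forall i, 0 <= u i) -> 0 <= running_min u k.
Proof. by move=> u0; apply/bigmin_geP; split. Qed.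

Lemma sqrtrDl_le (a b : R) : 0 <= a -> 0 <= b ->
  Num.sqrt (a ^+ 2 + b) <= a + Num.sqrt b.
Proof.
move=> a0 b0; rewrite -(@ler_pXn2r _ 2)// ?nnegrE ?addr_ge0 ?sqrtr_ge0//.
rewrite sqr_sqrtr ?addr_ge0 ?sqr_ge0// sqrrD sqr_sqrtr//.
have := mulr_ge0 a0 (sqrtr_ge0 b); lra.
Qed.

(** Replace every [u i] by the running minimum [M] and telescope: [S (M^2 - e^2) <= 2 (h 0 - b)].
    Subadditivity of the square root then separates [e]. *)
Lemma running_min_descent u g h (b e : R) (k : nat) :
  (forall i, 0 < g i) -> (forall i, 0 <= u i) -> 0 <= e ->
  (forall i, b <= h i) ->
  (forall i, h i.+1 <= h i - g i / 2 * (u i ^+ 2 - e ^+ 2)) ->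
  running_min u k <= e + Num.sqrt (2 * (h 0%N - b) / series g k.+1).
Proof.
move=> g0 u0 e0 hb hs; set M := running_min u k; set S := series g k.+1.
have M0 : 0 <= M by exact: running_min_ge0.
have S0 : 0 < S.
  rewrite /S /series /= big_nat_recr//=; apply: ltr_wpDl => //.
  by apply: sumr_ge0 => i _; exact: ltW.
have H j : (j <= k.+1)%N ->
    h j <= h 0%N - series g j / 2 * (M ^+ 2 - e ^+ 2).
  elim: j => [|j IH] jk; first by rewrite /series /= big_geq// mul0r mul0r subr0.
  have {}IH := IH (ltnW jk).
  have : g j / 2 * (M ^+ 2 - e ^+ 2) <= g j / 2 * (u j ^+ 2 - e ^+ 2).
    by rewrite ler_pM2l ?divr_gt0// lerD2r ler_pXn2r ?nnegrE// running_min_le.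
  have := hs j; rewrite seriesSr !mulrDl; lra.
have {}H : S * (M ^+ 2 - e ^+ 2) <= 2 * (h 0%N - b).
  have := H k.+1 (leqnn _); have := hb k.+1; rewrite -/S; lra.
have Q0 : 0 <= 2 * (h 0%N - b) / S.
  by apply: divr_ge0; [rewrite mulr_ge0// subr_ge0|exact: ltW].
apply: le_trans (sqrtrDl_le e0 Q0).
rewrite -[leLHS](ger0_norm M0) -sqrtr_sqr ler_wsqrtr// addrC -lerBlDr.
by rewrite ler_pdivlMr// mulrC.
Qed.

End running_min_theory.

(** * Partial sums of the stepsizes and comparison of the rates *)

Section rates.
Context {R : realType}.

(** Each of the [k + 1] terms is at least the last one. *)
Lemma series_powR_ge (p : R) k : 0 <= p ->
  k.+1%:R `^ (1 - p) <= series (fun i => (i.+1%:R `^ p)^-1) k.+1.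
Proof.
move=> p0; rewrite powRB ?pnatr_eq0 ?implybT// powRr1//.
rewrite /series /= big_mkord.
apply: (@le_trans _ _ (\sum_(i < k.+1) (k.+1%:R `^ p)^-1)).
  by rewrite sumr_const card_ord -[leRHS]mulr_natl.
apply: ler_sum => i _; rewrite lef_pV2 ?posrE ?powR_gt0//.
by apply: ge0_ler_powR => //; rewrite ?nnegrE// ler_nat ltn_ord.
Qed.

(** Induction with [ln (1 + x) <= x] at [x = 1 / (k + 1)]. *)
Lemma series_inv_ge_ln k : ln k.+1%:R <= series (fun i => i.+1%:R^-1 : R) k.
Proof.
elim: k => [|k IH]; first by rewrite ln1 /series /= big_geq.
have k0 : 0 < k.+1%:R :> R by [].
rewrite seriesSr; have -> : k.+2%:R = k.+1%:R * (1 + k.+1%:R^-1) :> R.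
  by rewrite mulrDr mulr1 divff ?pnatr_eq0// natr1.
have i0 : 0 < k.+1%:R^-1 :> R by rewrite invr_gt0.
rewrite lnM ?posrE ?addr_gt0// lerD// le_ln1Dx//.
by apply: lt_trans i0; rewrite oppr_lt0.
Qed.

(** The quantity under the root in [rate], isolated because it bounds the partial sums from below in
    both cases. *)
Definition growth (p : R) (k : nat) : R :=
  if p == 1 then ln k%:R else k%:R `^ (1 - p).

Lemma rateE (p : R) k : rate p k = 1 / Num.sqrt (growth p k).
Proof. by rewrite /rate /growth; case: ifP. Qed.

Lemma growth_gt0 (p : R) k : (1 < k)%N -> 0 < growth p k.
Proof.
move=> k1; rewrite /growth; case: ifP => _; last by rewrite powR_gt0// ltr0n ltnW.
by rewrite ln_gt0// ltr1n.
Qed.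

Lemma growth_le_series (p : R) k : (0 < k)%N -> 0 <= p <= 1 ->
  growth p k <= series (fun i => (i.+1%:R `^ p)^-1) k.+1.
Proof.
move=> k0 /andP[p0 p1]; rewrite /growth; case: ifPn => [/eqP ->|_].
  (* A sum of [k + 1] terms is compared with [ln (k + 2)]. *)
  apply: (@le_trans _ _ (ln k.+2%:R)).
    by rewrite ler_ln ?posrE ?ltr0n// ler_nat !leqW.
  apply: le_trans (series_inv_ge_ln _) _; rewrite /series /=.
  by apply: ler_sum => i _; rewrite powRr1.
apply: le_trans (series_powR_ge _ p0).
by apply: ge0_ler_powR; rewrite ?subr_ge0 ?nnegrE// ler_nat.
Qed.

Lemma rate0E k : rate (0 : R) k = 1 / Num.sqrt k%:R.
Proof. by rewrite /rate eq_sym oner_eq0 subr0 powRr1. Qed.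

(** For the logarithm, [ln k = 2 ln (sqrt k) <= 2 sqrt k], which is at most [e k] once
    [k >= (2 / e)^2]; for the power, [k^(1 - p) = k / k^p] and [k^p] eventually exceeds [1 / e]. *)
Lemma growth_le_linear (p e : R) : 0 < p <= 1 -> 0 < e ->
  \forall k \near \oo, growth p k <= e * k%:R.
Proof.
move=> /andP[p0 p1] e0; rewrite /growth; case: (p == 1).
  near=> k.
  have k0 : 0 < k%:R :> R by rewrite ltr0n; near: k; exact: nbhs_infty_gt.
  have sk : 0 < Num.sqrt k%:R :> R by rewrite sqrtr_gt0.
  have kE : k%:R = Num.sqrt k%:R ^+ 2 :> R by rewrite sqr_sqrtr ?ltW.
  rewrite {1 2}kE lnXn// -[ln _ *+ 2]mulr_natl [in leRHS]expr2 mulrA.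
  apply: (@le_trans _ _ (2 * Num.sqrt k%:R)).
    by rewrite ler_pM2l// ltW// ln_sublinear.
  rewrite ler_pM2r// mulrC -ler_pdivrMr//.
  have e2 : 0 <= 2 / e by rewrite divr_ge0// ltW.
  rewrite -(ger0_norm e2) -sqrtr_sqr ler_wsqrtr//.
  by near: k; exact: nbhs_infty_ger.
near=> k.
have k0 : 0 < k%:R :> R by rewrite ltr0n; near: k; exact: nbhs_infty_gt.
rewrite powRB; last by rewrite (gt_eqF k0) implybT.
rewrite powRr1 ?(ltW k0)// mulrC ler_pM2r//.
rewrite invf_ple ?posrE ?powR_gt0//.
have -> : e^-1 = (e^-1 `^ p^-1) `^ p.
  by rewrite -powRrM mulVf ?gt_eqF// powRr1// invr_ge0 ltW.
apply: ge0_ler_powR; rewrite ?nnegrE ?powR_ge0 ?(ltW p0) ?(ltW k0)//.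
by near: k; exact: nbhs_infty_ger.
Unshelve. all: by end_near. Qed.

Lemma rate0_littleo (p : R) : 0 < p <= 1 ->
  (rate 0 : nat -> R) =o_\oo (rate p : nat -> R).
Proof.
move=> p01; apply/eqoP => _/posnumP[e].
have e2 : 0 < e%:num ^+ 2 by rewrite exprn_gt0.
near=> k.
have k1 : (1 < k)%N by near: k; exact: nbhs_infty_gt.
have k0 : 0 < k%:R :> R by rewrite ltr0n ltnW.
(* The square of the target constant, because the rates involve square roots. *)
have gk : growth p k <= e%:num ^+ 2 * k%:R by near: k; exact: growth_le_linear.
have g0 := growth_gt0 p k1.
rewrite rate0E rateE !div1r !ger0_norm ?invr_ge0 ?sqrtr_ge0//.
rewrite ler_pdivlMr ?sqrtr_gt0// mulrC ler_pdivrMr ?sqrtr_gt0//.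
rewrite -[X in X * _](ger0_norm (ltW (gt0 e))) -sqrtr_sqr -sqrtrM ?sqr_ge0//.
exact: ler_wsqrtr.
Unshelve. all: by end_near. Qed.

End rates.

(** * Limit superior and explicit rates from the running bound *)

Section limits_of_running_bounds.
Context {R : realType}.
Implicit Types (v g : nat -> R).

Lemma limn_esup_le_sqrt_series v g (e D : R) : 0 <= D ->
  series g @ \oo --> +oo ->
  (forall k, v k <= e + Num.sqrt (D / series g k.+1)) ->
  (limn_esup (fun k => (v k)%:E) <= e%:E)%E.
Proof.
move=> D0 gy vb; apply/lee_addgt0Pr => d d0.
have d2 : 0 < d ^+ 2 by rewrite exprn_gt0.
have vd : \forall k \near \oo, v k <= e + d.
  (* Beyond [D / d^2] the quotient [D / series] is at most [d^2]; the added 1 makes the series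
     positive even when [D = 0]. *)
  have /cvgryPge /(_ (D / d ^+ 2 + 1)) [N _ HN] := gy.
  exists N => // k /= Nk; apply: le_trans (vb k) _; rewrite lerD2l.
  have Sk := HN k.+1 (leqW Nk).
  have S0 : 0 < series g k.+1.
    by apply: lt_le_trans Sk; rewrite ltr_wpDl// divr_ge0// ltW.
  rewrite -[leRHS](ger0_norm (ltW d0)) -sqrtr_sqr ler_wsqrtr//.
  rewrite ler_pdivrMr// mulrC -ler_pdivrMr//.
  by apply: le_trans Sk; rewrite lerDl.
(* The limit superior is an infimum of suprema over the sets of the filter, and this set is one of
   them. *)
apply: (@le_trans _ _ (ereal_sup [set (v k)%:E | k in [set k | v k <= e + d]])).
  by apply: ereal_inf_lbound; exists [set k | v k <= e + d].
by apply: ge_ereal_sup => _ [k /= vk <-]; rewrite lee_fin.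
Qed.

Lemma near_le_rate v g (e D c p : R) : 0 <= D -> 0 < c -> 0 <= p <= 1 ->
  (forall k, g k = c / k.+1%:R `^ p) ->
  (forall k, v k <= e + Num.sqrt (D / series g k.+1)) ->
  \forall k \near \oo, v k <= Num.sqrt (D / c) * rate p k + e.
Proof.
(* Starting at 2 makes [growth p k] positive, since [ln 1 = 0]. *)
move=> D0 c0 p01 gE vb; exists 2%N => // k /= k1.
apply: le_trans (vb k) _; rewrite addrC lerD2r rateE div1r.
have g0 := growth_gt0 p k1.
rewrite -sqrtrV ?(ltW g0)// -sqrtrM ?divr_ge0 ?(ltW c0)// ler_wsqrtr//.
rewrite -mulrA -invfM ler_wpM2l//.
have -> : series g k.+1 = c * series (fun i => (i.+1%:R `^ p)^-1) k.+1.
  by rewrite /series /= mulr_sumr; apply: eq_bigr => i _; rewrite gE.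
have gs := growth_le_series (ltnW k1) p01.
by rewrite lef_pV2 ?posrE ?mulr_gt0// ?ler_pM2l// (lt_le_trans g0 gs).
Qed.

End limits_of_running_bounds.

(** * Convergence of the inexact dual algorithm *)

Theorem corollary1 (R : realType) (m n : nat) (hm : (1 < m)%N) (hn : (0 < n)%N)
    (Y : set 'rV[R]_n) (f : 'I_m -> 'rV[R]_n -> R) (mu : 'I_m -> R)
    (e : 'I_m -> R) (gamma : nat -> R)
    (r : nat -> 'M[R]_(m, n)) (y : nat -> 'M[R]_(m, n))
    (lam : nat -> 'M[R]_(m.-1, n))
    (hY0 : Y !=set0) (hYcl : closed Y) (hYcv : convex_set Y)
    (hfsc : forall i, strictly_convex (f i))
    (hfcl : forall i, closed_function (f i))
    (hmu : forall i, 0 < mu i)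
    (hf : forall i, strongly_convex (mu i) (f i))
    (halg : inexact_dual_algorithm f Y gamma r y lam)
    (hr : forall i k, enorm (row i (r k)) <= e i)
    (hgamma : forall k, 0 < gamma k <= 1 / lipschitz_const hm mu)
    (hsum : series gamma @ \oo --> +oo) :
  let h := neg_dual f Y in
  let gmin := running_min (fun i => enorm (gradient h (lam i))) in
  let eps := total_error e in
  (forall l, dual_fun f Y l \is a fin_num /\ differentiable h l) /\
  (limn_esup (fun k => (gmin k)%:E) <= eps%:E)%E /\
  (forall c p : R, 0 < c <= 1 / lipschitz_const hm mu -> 0 <= p <= 1 ->
    (forall k, gamma k = c / k.+1%:R `^ p) ->
    exists C : R, \forall k \near \oo, gmin k <= C * rate p k + eps) /\
  (forall c : R, 0 < c <= 1 / lipschitz_const hm mu ->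
    (forall k, gamma k = c) ->
    exists C : R, \forall k \near \oo, gmin k <= C * (1 / Num.sqrt k%:R) + eps) /\
  (forall k, rate 0 k = 1 / Num.sqrt (k%:R : R)) /\
  (forall p : R, 0 < p <= 1 ->
    (rate 0 : nat -> R) =o_\oo (rate p : nat -> R)).
Proof.
move=> h gmin eps.
(* The first iterate supplies the minimizer from which existence spreads to all multipliers. *)
have argminP l : exists z, is_argmin (prodY Y) (lagrangian f l) z.
  exact: (lagrangian_argmin_exists hm hYcl hYcv hfcl hmu hf l (halg 0%N).1).
have [x Yx] := hY0.
have [D D0 gminD] : exists2 D, 0 <= D &
    forall k, gmin k <= eps + Num.sqrt (D / series gamma k.+1).
  (* Twice the initial gap between [h] and its lower bound at a consensus point. *)
  exists (2 * (h (lam 0%N) - - \sum_i f i x)).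
    by rewrite mulr_ge0// subr_ge0 (neg_dual_lower_bound Yx (halg 0%N).1).
  move=> k.
  apply: (@running_min_descent _ _ gamma (fun i => h (lam i))) => [i|i||i|i].
  - by have /andP[] := hgamma i.
  - exact: enorm_ge0.
  - exact: sqrtr_ge0.
  - exact: (neg_dual_lower_bound Yx (halg i).1).
  - have [ymin lamE] := halg i; have [y'min _] := halg i.+1.
    rewrite /= lamE; rewrite lamE in y'min.
    apply: (neg_dual_inexact_step hYcl hYcv hfcl hmu hf (hgamma i) ymin y'min).
    by apply: enorm_diffA_le_total_error => j; exact: hr.
have rates c p : 0 < c <= 1 / lipschitz_const hm mu -> 0 <= p <= 1 ->
    (forall k, gamma k = c / k.+1%:R `^ p) ->
    exists C : R, \forall k \near \oo, gmin k <= C * rate p k + eps.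
  move=> /andP[c0 _] p01 gE; exists (Num.sqrt (D / c)).
  exact: near_le_rate gE gminD.
split=> [l|].
  have [z zmin] := argminP l; split; first by rewrite (dual_fun_argmin zmin).
  exact: (differentiable_neg_dual hm hYcl hYcv hfcl hmu hf zmin).
split; first exact: limn_esup_le_sqrt_series gminD.
split; first exact: rates.
split=> [c c0 gE|].
  have [||C HC] := rates c 0 c0.
  - by rewrite lexx ler01.
  - by move=> k; rewrite powRr0 divr1.
  by exists C; apply: filterS HC => k; rewrite rate0E.
by split; [exact: rate0E|exact: rate0_littleo].
Qed.
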